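(* Let $E:[0,T]\times\mathbb{R}^m\rightrightarrows\mathbb{R}^m$ be a set-valued map such that: (E1) $E(t,z)$ is nonempty, closed and convex for all $(t,z)$; (E6) $(t,z)\mapsto E(t,z)$ has closed graph and is lower semicontinuous; (ELC) for every $R>0$ there is an integrable $k_R:[0,T]\to[0,\infty)$ with $E(t,x)\subset E(t,y)+k_R(t)|x-y|(\bar B^{m-1}\times[-1,1])$ for all $t\in[0,T]$, $x,y\in\bar B_R$. Let $P:[0,T]\rightrightarrows\mathbb{R}^m$ have closed graph and nonempty values, and assume $$\forall t\in(0,T),\ \forall z\in P(t):\quad \{1\}\times E(t,z)\subset\overline{\mathrm{conv}}\big(T_{\mathrm{gph}\,P}(t,z)\big).$$ Then for all $t_0\in(0,T)$ and $z_0\in P(t_0)$, every absolutely continuous $z:[t_0,T]\to\mathbb{R}^m$ with $\dot z(t)\in E(t,z(t))$ a.e. and $z(t_0)=z_0$ satisfies $z(t)\in P(t)$ for all $t\in[t_0,T]$.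
   Context: $\bar B_R$ is the closed ball of radius $R$ about $0$ in $\mathbb{R}^m$; $\bar B^{m-1}$ is the closed unit ball of $\mathbb{R}^{m-1}$, and $\mathbb{R}^m$ is identified with $\mathbb{R}^{m-1}\times\mathbb{R}$. A set-valued map $F$ is lower semicontinuous if for every open $U$ the set $\{z:F(z)\cap U\ne\emptyset\}$ is open. $\mathrm{gph}\,P=\{(t,z):z\in P(t)\}$. For $K\subset\mathbb{R}^k$ and $w\in K$, the contingent cone is $T_K(w)=\{v:\liminf_{\tau\to0^+}d(w+\tau v,K)/\tau=0\}$, with $d$ the Euclidean distance to a set. $\overline{\mathrm{conv}}$ denotes closed convex hull. *)

(* Defs.v *)
From mathcomp Require Import all_boot all_order all_algebra.
From mathcomp Require Import all_classical all_reals all_analysis.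
Set Implicit Arguments. Unset Strict Implicit. Unset Printing Implicit Defensive.
Import Order.TTheory GRing.Theory Num.Theory.
Import numFieldNormedType.Exports.
Local Open Scope classical_set_scope.
Local Open Scope ring_scope.

Section Defs.
Variable R : realType.

Definition enorm (m : nat) (v : 'rV[R]_m) : R := Num.sqrt (\sum_(i < m) v ord0 i ^+ 2).

Definition enorm2 (m : nat) (p : R * 'rV[R]_m) : R :=
  Num.sqrt (p.1 ^+ 2 + enorm p.2 ^+ 2).

Definition dist2 (m : nat) (p : R * 'rV[R]_m) (K : set (R * 'rV[R]_m)) : R :=
  inf [set enorm2 (p.1 - q.1, p.2 - q.2) | q in K].

(* Contingent cone T_K(w) = {v | liminf_{tau->0+} d(w + tau v, K)/tau = 0}.
   Since the quotient is >= 0, the liminf is 0 iff for every eps, delta > 0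
   there is tau in (0, delta) with d(w + tau v, K)/tau < eps. *)
Definition contingent_cone (m : nat) (K : set (R * 'rV[R]_m)) (w : R * 'rV[R]_m)
  : set (R * 'rV[R]_m) :=
  [set v | forall eps delta : R, 0 < eps -> 0 < delta ->
     exists tau : R, [/\ 0 < tau, tau < delta &
       dist2 (w.1 + tau * v.1, w.2 + tau *: v.2) K / tau < eps]].

Definition convex2 (m : nat) (C : set (R * 'rV[R]_m)) : Prop :=
  forall p q (l : R), C p -> C q -> 0 <= l -> l <= 1 ->
    C (l * p.1 + (1 - l) * q.1, l *: p.2 + (1 - l) *: q.2).

Definition conv_hull2 (m : nat) (A : set (R * 'rV[R]_m)) : set (R * 'rV[R]_m) :=
  [set p | forall C, convex2 C -> A `<=` C -> C p].

Definition cl_conv_hull2 (m : nat) (A : set (R * 'rV[R]_m)) : set (R * 'rV[R]_m) :=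
  closure (conv_hull2 A).

Definition lsc_on (X Y : topologicalType) (D : set X) (F : X -> set Y) : Prop :=
  forall U : set Y, open U ->
    exists V : set X, open V /\ (forall p, D p -> (V p <-> (F p `&` U !=set0))).

Definition box (n : nat) : set 'rV[R]_n.+1 :=
  [set v | \sum_(i < n.+1 | i != ord_max) v ord0 i ^+ 2 <= 1 /\ `|v ord0 ord_max| <= 1].

Definition abs_cont_on (m : nat) (a b : R) (z : R -> 'rV[R]_m) : Prop :=
  forall eps : R, 0 < eps -> exists delta : R, 0 < delta /\
    forall (k : nat) (u v : 'I_k -> R),
      (forall i, a <= u i /\ u i <= v i /\ v i <= b) ->
      (forall i j, i != j -> v i <= u j \/ v j <= u i) ->
      \sum_(i < k) (v i - u i) < delta ->
      \sum_(i < k) enorm (z (v i) - z (u i)) < eps.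

End Defs.

(* Main.v *)
Require Import Defs.
From mathcomp Require Import all_boot all_order all_algebra ring lra.
From mathcomp Require Import all_classical all_reals all_analysis measurable_realfun.
Import Order.TTheory GRing.Theory Num.Theory.
Import numFieldNormedType.Exports.
Local Open Scope classical_set_scope.
Local Open Scope ring_scope.

(* Let K be the graph of P. At a nearest point of K the residual is a proximal
   normal, hence nonpositive on the contingent cone and on its closed convex
   hull; with the lower semicontinuity of E this upgrades the tangency condition
   to: every (1, e) with e in E(t, y) is a contingent vector of K at (t, y).

   Given a trajectory z, compare |z(t) - y| for y in P(t) with
   phi(t) = exp(2 kappa(t)) (psi(t) + 2 c (t - t0)), where kappa is nondecreasing
   with right derivative at least k a.e., and psi <= c is nondecreasing and absorbs
   the motion of z, and that of a bounded selection of E, over the null set where z'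
   or the derivative of kappa is bad.  From any (t, y) with |z(t) - y| <= phi(t), a
   contingent direction in E(t, y) close to z'(t) (by the Lipschitz condition) leads
   to a later pair with the same property, and the set of such times is closed from
   the left, so it reaches every t1; then c -> 0. *)

(** * Euclidean inner product and norms on [R * 'rV[R]_m] *)

Section InnerProduct.
Context {R : realType} {m : nat}.
Implicit Types (p q r : R * 'rV[R]_m) (u v : 'rV[R]_m).

Definition dot2 p q : R :=
  p.1 * q.1 + \sum_(i < m) p.2 ord0 i * q.2 ord0 i.

Lemma dot2C p q : dot2 p q = dot2 q p.
Proof. by rewrite /dot2 mulrC; congr +%R; apply: eq_bigr => i _; rewrite mulrC. Qed.

Lemma dot2Dr p q r : dot2 p (q + r) = dot2 p q + dot2 p r.
Proof.
rewrite /dot2 addrACA -big_split/= mulrDr; congr +%R.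
by apply: eq_bigr => i _; rewrite mxE mulrDr.
Qed.

Lemma dot2Zr p (a : R) q : dot2 p (a *: q) = a * dot2 p q.
Proof.
rewrite /dot2 mulrDr mulr_sumr mulrCA; congr +%R.
by apply: eq_bigr => i _; rewrite mxE mulrCA.
Qed.

Lemma dot2Nr p q : dot2 p (- q) = - dot2 p q.
Proof. by rewrite -scaleN1r dot2Zr mulN1r. Qed.

Lemma dot2Dl p q r : dot2 (p + q) r = dot2 p r + dot2 q r.
Proof. by rewrite ![dot2 _ r]dot2C dot2Dr. Qed.

Lemma dot2Zl (a : R) p q : dot2 (a *: p) q = a * dot2 p q.
Proof. by rewrite ![dot2 _ q]dot2C dot2Zr. Qed.

Lemma dot2Nl p q : dot2 (- p) q = - dot2 p q.
Proof. by rewrite ![dot2 _ q]dot2C dot2Nr. Qed.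

Lemma dot2_ge0 p : 0 <= dot2 p p.
Proof.
by rewrite addr_ge0 -?expr2 ?sqr_ge0// sumr_ge0// => i _; rewrite -expr2 sqr_ge0.
Qed.

Lemma enorm_ge0 v : 0 <= enorm v. Proof. exact: sqrtr_ge0. Qed.

Lemma enorm2_ge0 p : 0 <= enorm2 p. Proof. exact: sqrtr_ge0. Qed.

Lemma enorm2E p : enorm2 p = Num.sqrt (dot2 p p).
Proof.
rewrite /enorm2 /dot2 -expr2 /enorm sqr_sqrtr; last by rewrite sumr_ge0// => i _; rewrite sqr_ge0.
by under [in RHS]eq_bigr do rewrite -expr2.
Qed.

Lemma enorm2_sqr p : enorm2 p ^+ 2 = dot2 p p.
Proof. by rewrite enorm2E sqr_sqrtr// dot2_ge0. Qed.

Lemma enorm2_pair0 v : enorm2 (0, v) = enorm v.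
Proof. by rewrite /enorm2/= expr0n add0r sqrtr_sqr ger0_norm// enorm_ge0. Qed.

Lemma enorm2Z a p : enorm2 (a *: p) = `|a| * enorm2 p.
Proof. by rewrite !enorm2E dot2Zl dot2Zr mulrA -expr2 sqrtrM ?sqr_ge0// sqrtr_sqr. Qed.

Lemma enorm20 : enorm2 (0 : R * 'rV[R]_m) = 0.
Proof. by rewrite -(scale0r 0) enorm2Z normr0 mul0r. Qed.

Lemma enorm2N p : enorm2 (- p) = enorm2 p.
Proof. by rewrite -scaleN1r enorm2Z normrN1 mul1r. Qed.

(** Cauchy-Schwarz, from the nonnegativity of [dot2] at [p - a *: q] with [a = |p| / |q|]. *)
Lemma dot2_le p q : dot2 p q <= enorm2 p * enorm2 q.
Proof.
have H x y (a : R) : 0 <= enorm2 x ^+ 2 - 2 * a * dot2 x y + a ^+ 2 * enorm2 y ^+ 2.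
  have := dot2_ge0 (x - a *: y).
  rewrite dot2Dl !dot2Dr !dot2Nl !dot2Nr !dot2Zl !dot2Zr (dot2C y x) !enorm2_sqr.
  by congr (0 <= _); ring.
(* When [|y| = 0] the quadratic of [H] is affine in [a]; a positive [dot2 x y] would let it take the
   value -1. *)
have D0 x y : enorm2 y = 0 -> dot2 x y <= 0.
  move=> y0; rewrite leNgt; apply/negP => xy.
  have := H x y ((enorm2 x ^+ 2 + 1) / (2 * dot2 x y)).
  have -> : 2 * ((enorm2 x ^+ 2 + 1) / (2 * dot2 x y)) * dot2 x y = enorm2 x ^+ 2 + 1.
    by field; rewrite gt_eqF.
  by rewrite y0 expr0n mulr0; lra.
have [q0|q0] := eqVneq (enorm2 q) 0; first by rewrite q0 mulr0 D0.
have [p0|p0] := eqVneq (enorm2 p) 0; first by rewrite p0 mul0r dot2C D0.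
have := H p q (enorm2 p / enorm2 q).
have -> : enorm2 p ^+ 2 - 2 * (enorm2 p / enorm2 q) * dot2 p q +
    (enorm2 p / enorm2 q) ^+ 2 * enorm2 q ^+ 2 =
    2 * enorm2 p / enorm2 q * (enorm2 p * enorm2 q - dot2 p q) by field.
by rewrite pmulr_rge0 ?subr_ge0// divr_gt0// ?mulr_gt0// lt_def ?p0 ?q0 enorm2_ge0.
Qed.

Lemma enorm2D p q : enorm2 (p + q) <= enorm2 p + enorm2 q.
Proof.
rewrite -(@ler_pXn2r _ 2)// ?nnegrE ?addr_ge0 ?enorm2_ge0//.
rewrite enorm2_sqr dot2Dl !dot2Dr (dot2C q p) -!enorm2_sqr.
have := dot2_le p q; lra.
Qed.

Lemma enormD u v : enorm (u + v) <= enorm u + enorm v.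
Proof.
have := enorm2D (0, u) (0, v).
suff -> : (0, u) + (0, v) = (0, u + v) :> R * 'rV[R]_m by rewrite !enorm2_pair0.
by congr pair; rewrite /= addr0.
Qed.

Lemma enormZ a v : enorm (a *: v) = `|a| * enorm v.
Proof.
have := enorm2Z a (0, v).
suff -> : a *: (0, v) = (0, a *: v) :> R * 'rV[R]_m by rewrite !enorm2_pair0.
by congr pair; rewrite /= /GRing.scale/= mulr0.
Qed.

Lemma enormN v : enorm (- v) = enorm v.
Proof. by rewrite -scaleN1r enormZ normrN1 mul1r. Qed.

Lemma enormB u v : enorm (u - v) = enorm (v - u).
Proof. by rewrite -enormN opprB. Qed.

Lemma enorm0 : enorm (0 : 'rV[R]_m) = 0.
Proof. by rewrite -(scale0r 0) enormZ normr0 mul0r. Qed.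

Lemma ler_fst_enorm2 p : `|p.1| <= enorm2 p.
Proof. by rewrite /enorm2 -(sqrtr_sqr p.1) ler_wsqrtr// lerDl sqr_ge0. Qed.

Lemma ler_snd_enorm2 p : enorm p.2 <= enorm2 p.
Proof.
by rewrite /enorm2 -{1}(ger0_norm (enorm_ge0 p.2)) -sqrtr_sqr ler_wsqrtr// lerDr sqr_ge0.
Qed.

(** The norm on the left is the sup norm carrying the topology, so Euclidean bounds pass to
    neighbourhoods. *)
Lemma ler_norm_enorm v : `|v| <= enorm v.
Proof.
rewrite [leLHS]/Num.norm/= mx_normrE; apply/bigmax_leP; split; first exact: enorm_ge0.
move=> [i j] _ /=; rewrite ord1 -sqrtr_sqr ler_wsqrtr// (bigD1 j)//= lerDl.
by apply: sumr_ge0 => k _; rewrite sqr_ge0.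
Qed.

Lemma dot2_continuous p : continuous (dot2 p).
Proof.
move=> q; rewrite /dot2; apply: cvgD.
  by apply: cvgM; [exact: cvg_cst|exact: cvg_fst].
apply: cvg_big => [|i _]; first exact: add_continuous.
  apply: cvgM; first exact: cvg_cst.
apply: (@cvg_comp _ _ _ snd (fun v : 'rV[R]_m => v ord0 i)); first exact: cvg_snd.
exact: coord_continuous.
Qed.

Lemma enorm_continuous : continuous (@enorm R m).
Proof.
move=> v; rewrite /enorm; apply: continuous_comp; last exact: sqrt_continuous.
apply: (@cvg_big _ _ _ _ _ _ _ (nbhs v)) => [|i _]; first exact: add_continuous.
  rewrite expr2; under eq_fun do rewrite expr2.
by apply: cvgM; exact: coord_continuous.
Qed.

Lemma enorm2_continuous : continuous (@enorm2 R m).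
Proof.
move=> p; rewrite /enorm2; apply: continuous_comp; last exact: sqrt_continuous.
have c2 : enorm q.2 @[q --> p] --> enorm p.2.
  by apply: continuous_comp; [exact: cvg_snd|exact: enorm_continuous].
apply: cvgD; rewrite expr2; under eq_fun do rewrite expr2.
  by apply: cvgM; exact: cvg_fst.
by apply: cvgM; exact: c2.
Qed.

End InnerProduct.

(** * Continuous induction on an interval *)

(** The supremum of the points of [A] in [[a, b]] lies in [A] by closedness from the left, and a
    step from it would pass it unless it is [b]. One step length per point suffices, since [A] need
    not be an interval. *)
Lemma real_induction {R : realType} (a b : R) (A : set R) : a <= b -> A a ->
  (forall s, a <= s -> s <= b ->
    (forall e, 0 < e -> exists x, [/\ A x, a <= x, x <= s & s - e < x]) -> A s) ->
  (forall s, a <= s -> s < b -> A s -> exists h, [/\ 0 < h, s + h <= b & A (s + h)]) ->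
  A b.
Proof.
move=> ab Aa Acl Astep.
pose B := [set x | [/\ A x, a <= x & x <= b]].
have supB : has_sup B.
  by split; [exists a; rewrite /B/=|exists b => x []].
have leB x : B x -> x <= sup B by move=> Bx; apply: sup_upper_bound.
have aB : a <= sup B by apply: leB.
have Bb : sup B <= b by apply: ge_sup => [|x []]//; exists a.
have As : A (sup B).
  apply: Acl => // e e0; have [x Bx xs] := sup_adherent e0 supB.
  by exists x; split=> //; [case: Bx|case: Bx|exact: leB].
move: Bb; rewrite le_eqVlt => /predU1P[<-//|sb].
have [h [h0 hb Ah]] := Astep _ aB sb As.
have : B (sup B + h) by split=> //; lra.
by move=> /leB; lra.
Qed.

Lemma closed_sublevel {R : realType} {T : topologicalType} (f : T -> R) (r : R) :
  continuous f -> closed [set x | f x <= r].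
Proof.
move=> cf; rewrite -[X in closed X]/(f @^-1` [set y | y <= r]).
apply: preimage_closed; last exact: closed_le.
by move=> x _; exact: cf.
Qed.

(** * Nearest points, proximal normals and contingent vectors *)

Section Contingent.
Context {R : realType} {m : nat}.
Implicit Types (p q x y v w : R * 'rV[R]_m) (K : set (R * 'rV[R]_m)).

Lemma enorm_sub_continuous (x : 'rV[R]_m) :
  continuous (fun v : 'rV[R]_m => enorm (x - v)).
Proof.
move=> v; apply: (@continuous_comp _ _ _ (fun u : 'rV[R]_m => x - u) (@enorm R m) v);
  last exact: enorm_continuous.
exact: (@cvgB R 'rV[R]_m _ (nbhs v) _ (fun=> x) idfun x v (cvg_cst _) cvg_id).
Qed.

Lemma enorm2_sub_continuous x :
  continuous (fun v : R * 'rV[R]_m => enorm2 (x - v)).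
Proof.
move=> v; apply: (@continuous_comp _ _ _ (fun u : R * 'rV[R]_m => x - u) (@enorm2 R m) v);
  last exact: enorm2_continuous.
exact: (@cvgB R (R * 'rV[R]_m)%type _ (nbhs v) _ (fun=> x) idfun x v (cvg_cst _) cvg_id).
Qed.

Lemma compact_enorm_ball (x : 'rV[R]_m) (r : R) : compact [set v | enorm (x - v) <= r].
Proof.
apply: bounded_closed_compact.
  exists (`|x| + r); split; first exact: num_real.
  move=> M xrM v /= xvr; apply: le_trans (ltW xrM).
  rewrite -{1}(subKr x v) (le_trans (ler_normB _ _))// lerD2l.
  exact: le_trans (ler_norm_enorm _) xvr.
apply: closed_sublevel; exact: enorm_sub_continuous.
Qed.

Lemma compact_enorm2_ball x (r : R) : compact [set q | enorm2 (x - q) <= r].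
Proof.
apply: (@subclosed_compact _ _ (`[x.1 - r, x.1 + r] `*` [set v | enorm (x.2 - v) <= r])).
- apply: closed_sublevel; exact: enorm2_sub_continuous.
- apply: compact_setX; first exact: segment_compact.
  exact: compact_enorm_ball.
- move=> q /= qr; split => /=; last exact: le_trans (ler_snd_enorm2 (x - q)) qr.
  have := le_trans (ler_fst_enorm2 (x - q)) qr.
  rewrite ler_norml in_itv/= => /andP[]; lra.
Qed.

Lemma nearest_point K x : closed K -> K !=set0 ->
  exists y, K y /\ forall q, K q -> enorm2 (x - y) <= enorm2 (x - q).
Proof.
move=> Kcl [q0 Kq0]; pose r := enorm2 (x - q0).
pose A := K `&` [set q | enorm2 (x - q) <= r].
have cA : compact A.
  rewrite /A setIC; apply: compact_closedI => //; exact: compact_enorm2_ball.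
have [||y] := @compact_EVT_min _ R (fun q => enorm2 (x - q)) A _ cA.
- by exists q0; split=> //=.
- apply: continuous_subspaceT; exact: enorm2_sub_continuous.
rewrite inE => -[Ky yr] ymin; exists y; split=> // q Kq.
have [qr|/ltW qr] := leP (enorm2 (x - q)) r; last exact: le_trans yr qr.
by apply: ymin; rewrite inE.
Qed.

(** If [c = dot2 (x - y) v] were positive, a point of [K] close to [y + t v] would be nearer to [x]
    than [y] is. *)
Lemma proximal_contingent K x y v : K y ->
  (forall q, K q -> enorm2 (x - y) <= enorm2 (x - q)) ->
  contingent_cone K y v -> dot2 (x - y) v <= 0.
Proof.
move=> Ky ymin Tv; rewrite leNgt; apply/negP; set p := x - y => c_gt0.
have := enorm2_ge0 p; have := enorm2_ge0 v; set c := dot2 p v in c_gt0 *.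
set N := enorm2 p; set L := enorm2 v => L0 N0.
(* With [e |p| <= c / 2] and [t (L + 1)^2 <= c / 2], the squared distance changes by at most
   [- 2 t c + t c + t c / 2 < 0]. *)
have e0 : 0 < Num.min 1 (c / (2 * (N + 1))).
  by rewrite lt_min ltr01 divr_gt0// mulr_gt0// ltr_wpDl.
have d0 : 0 < c / (2 * (L + 1) ^+ 2).
  by rewrite divr_gt0// mulr_gt0// exprn_gt0// ltr_wpDl.
have [t [t0 td]] := Tv _ _ e0 d0.
move: e0; set e := Num.min _ _ => e0.
have e1 : e <= 1 by rewrite ge_min lexx.
have eN : e * N <= c / 2.
  have : e <= c / (2 * (N + 1)) by rewrite ge_min lexx orbT.
  rewrite ler_pdivlMr ?mulr_gt0 ?ltr_wpDl//; nra.
(* The infimum is over a nonempty set because [y] is in [K], so some [q] in [K] comes within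
   [e t]. *)
rewrite ltr_pdivrMr// /dist2 => /inf_lt[|_ [q Kq <-] qe].
  by exists (enorm2 (y.1 + t * v.1 - y.1, y.2 + t *: v.2 - y.2)), y.
have {}qe : enorm2 (y + t *: v - q) < e * t by exact: qe.
set r := y + t *: v - q in qe.
have xq : x - q = p + (r - t *: v).
  by rewrite /p /r (addrAC y) addrK addrA subrK.
have : enorm2 p ^+ 2 <= enorm2 (x - q) ^+ 2.
  by rewrite ler_pXn2r ?nnegrE ?enorm2_ge0// ymin.
have dpd : dot2 p (r - t *: v) = dot2 p r - t * c by rewrite dot2Dr dot2Nr dot2Zr.
move: dpd; rewrite xq; set d := r - t *: v => dpd.
rewrite !enorm2_sqr dot2Dl (dot2Dr p p d) (dot2Dr d p d) (dot2C d p) dpd -[dot2 d d]enorm2_sqr.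
have rv : enorm2 d <= t * (L + 1).
  rewrite (le_trans (enorm2D _ _))// enorm2N enorm2Z gtr0_norm//.
  by rewrite mulrDr mulr1 addrC lerD2l (le_trans (ltW qe))// ger_pMl.
have pr : dot2 p r <= N * (e * t).
  by rewrite (le_trans (dot2_le _ _))// ler_wpM2l// ltW.
have rv2 : enorm2 d ^+ 2 <= t * (c / 2).
  rewrite (@le_trans _ _ ((t * (L + 1)) ^+ 2))//.
    by rewrite ler_pXn2r ?nnegrE ?enorm2_ge0// mulr_ge0 ?addr_ge0// ltW.
  rewrite exprMn expr2 -mulrA ler_pM2l//.
  have L1 : 0 < L + 1 by rewrite ltr_wpDl.
  by move: td; rewrite ltr_pdivlMr; [lra|rewrite mulr_gt0 ?exprn_gt0].
have tN : t * (e * N) <= t * (c / 2) by rewrite ler_pM2l.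
have tc : 0 < t * c by rewrite mulr_gt0.
by move: tN tc rv2 pr; lra.
Qed.

(** The half-space [dot2 (x - y) u <= 0] is closed and convex, so it contains the closed convex hull
    as soon as it contains the cone. *)
Lemma proximal_cl_conv K x y v : K y ->
  (forall q, K q -> enorm2 (x - y) <= enorm2 (x - q)) ->
  cl_conv_hull2 (contingent_cone K y) v -> dot2 (x - y) v <= 0.
Proof.
move=> Ky ymin; set p := x - y.
have Hcl : closed [set u | dot2 p u <= 0].
  by apply: closed_sublevel; exact: dot2_continuous.
move=> hv; apply: Hcl; apply: closureS hv => u; apply.
- move=> a b l /= pa pb l0 l1.
  rewrite -[(_, _)]/(l *: a + (1 - l) *: b) dot2Dr !dot2Zr.
  nra.
- by move=> u' /=; exact: proximal_contingent.
Qed.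

(** Let [f t] be the distance from [w + t v] to [K]. At a nearest point the residual pairs
    nonpositively with a hull vector [u] within [eps / 2] of [v], so [f^2] has growth rate at most
    [eps f], and [f] at most [eps]. *)
Lemma liminf_cl_conv_contingent K w v (eps : R) : closed K -> K w -> 0 < eps ->
  (forall e, 0 < e -> exists2 d, 0 < d & forall y, K y -> enorm2 (y - w) < d ->
     exists2 u, cl_conv_hull2 (contingent_cone K y) u & enorm2 (u - v) <= e) ->
  exists2 d, 0 < d & forall t, 0 <= t -> t < d ->
    exists2 q, K q & enorm2 (w + t *: v - q) <= eps * t.
Proof.
move=> Kcl Kw eps0 lim; have [d d0 Hd] := lim _ (divr_gt0 eps0 (ltr0n R 2)).
pose L := enorm2 v; have L0 : 0 <= L := enorm2_ge0 v.
have L1 : 0 < 2 * L + 1 by rewrite ltr_wpDl// mulr_ge0.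
have [pr prP] : exists f : R * 'rV[R]_m -> R * 'rV[R]_m, forall x, K (f x) /\
    forall q, K q -> enorm2 (x - f x) <= enorm2 (x - q).
  have /boolp.choice[f fP] x := nearest_point K x Kcl (ex_intro _ w Kw).
  by exists f.
(* A nearest point to [w + s v] is within [2 s L] of [w], hence within [d]. *)
exists (d / (2 * L + 1)); first exact: divr_gt0.
move=> t1 t10; rewrite ltr_pdivlMr// => t1d.
pose X t := w + t *: v; pose f t := enorm2 (X t - pr (X t)).
exists (pr (X t1)); first by case: (prP (X t1)).
(* The slack [eta] keeps the bound [B] positive where [f] vanishes, so that steps have positive
   length. *)
suff H eta : 0 < eta -> f t1 <= eta + eps * t1.
  by apply/ler_addgt0Pr => eta eta0; rewrite [leRHS]addrC; exact: H.
move=> eta0.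
have XB s h : X (s + h) = X s + h *: v by rewrite /X scalerDl addrA.
apply: (@real_induction _ 0 t1 (fun t => f t <= eta + eps * t)) => //.
- rewrite mulr0 addr0 /f /X scale0r addr0; case: (prP w) => _ /(_ _ Kw).
  by rewrite subrr enorm20 => H; exact: le_trans H (ltW _).
- move=> s s0 st Hs; apply/ler_addgt0Pr => e e0.
  have e1 : 0 < e / (L + 1) by rewrite divr_gt0// ltr_wpDl.
  have [x [Hx x0 xs sx]] := Hs _ e1.
  have fsx : f s <= f x + (s - x) * L.
    rewrite {1}/f; case: (prP (X s)) => _ /(_ (pr (X x)) (prP _).1) H.
    apply: (le_trans H).
    have -> : X s = X x + (s - x) *: v by rewrite -XB; congr X; ring.
    rewrite addrAC (le_trans (enorm2D _ _))// enorm2Z ger0_norm ?subr_ge0//.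
  have sxe : (s - x) * (L + 1) <= e.
    by rewrite -ler_pdivlMr ?ltr_wpDl// lerBlDr -lerBlDl ltW.
  have exs : eps * x <= eps * s by rewrite ler_pM2l.
  move: fsx Hx; move: (f s) (f x) => fs fx; clear -sxe exs xs; lra.
- move=> s s0 st fs.
  pose B := eta + eps * s.
  have B0 : 0 < B by rewrite ltr_pwDl// mulr_ge0// ltW.
  (* The square of the bound grows by at least [2 h B eps]: half covers the first-order term, half
     covers [h^2 L^2]. *)
  pose h := Num.min (t1 - s) (B * eps / (L ^+ 2 + 1)).
  have h0 : 0 < h by rewrite lt_min subr_gt0 st divr_gt0 ?mulr_gt0// ltr_wpDl ?sqr_ge0.
  have ht : h <= t1 - s by rewrite ge_min lexx.
  have hB : h * L ^+ 2 <= B * eps.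
    have : h <= B * eps / (L ^+ 2 + 1) by rewrite ge_min lexx orbT.
    by rewrite ler_pdivlMr ?ltr_wpDl ?sqr_ge0//; lra.
  exists h; split=> //; first by lra.
  have [Ky ymin] := prP (X s); set y := pr (X s) in Ky ymin.
  have yw : enorm2 (y - w) < d.
    have -> : y - w = (X s - w) - (X s - y) by rewrite opprB [RHS]addrC subrKA.
    rewrite (le_lt_trans (enorm2D _ _))// enorm2N.
    have Xw : enorm2 (X s - w) = s * L by rewrite /X addrAC subrr add0r enorm2Z ger0_norm.
    have := ymin w Kw; rewrite Xw => yXs; nra.
  have [u Tu uv] := Hd y Ky yw.
  have pu : dot2 (X s - y) u <= 0 := proximal_cl_conv _ _ _ _ Ky ymin Tu.
  have pv : dot2 (X s - y) v <= f s * (eps / 2).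
    have -> : v = u - (u - v) by rewrite subKr.
    rewrite dot2Dr dot2Nr -(dot2Nr _ (u - v)).
    rewrite -[leRHS]add0r lerD// (le_trans (dot2_le _ _))// enorm2N ler_wpM2l//.
    exact: enorm2_ge0.
  have : f (s + h) ^+ 2 <= (eta + eps * (s + h)) ^+ 2.
    (* The nearest point [y] at parameter [s] serves as competitor at [s + h]. *)
    apply: (@le_trans _ _ (enorm2 (X s - y + h *: v) ^+ 2)).
      rewrite ler_pXn2r ?nnegrE ?enorm2_ge0// /f.
      have -> : X s - y + h *: v = X (s + h) - y by rewrite XB addrAC.
      exact: (prP (X (s + h))).2.
    rewrite enorm2_sqr dot2Dl !(dot2Dr _ (X s - y)) dot2Zl !dot2Zr (dot2C v).
    rewrite -enorm2_sqr -/(f s) dot2Zl -enorm2_sqr -/L.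
    have -> : eta + eps * (s + h) = B + eps * h by rewrite /B; ring.
    have F0 : 0 <= f s := enorm2_ge0 _.
    have FB : f s ^+ 2 <= B ^+ 2 by rewrite ler_pXn2r// nnegrE ltW.
    have hp : h * dot2 (X s - y) v <= h * (B * (eps / 2)).
      by rewrite ler_pM2l// (le_trans pv)// ler_pM2r// divr_gt0.
    have hL : h * (h * L ^+ 2) <= h * (B * eps) by rewrite ler_pM2l.
    have := sqr_ge0 (eps * h); lra.
  rewrite ler_pXn2r ?nnegrE ?enorm2_ge0// addr_ge0 ?(ltW eta0)// mulr_ge0 ?(ltW eps0)//.
  by rewrite addr_ge0// ltW.
Qed.

End Contingent.

(** * Lower semicontinuous set-valued maps *)

Section LowerSemicontinuity.
Context {R : realType} {m : nat}.
Implicit Types (p q w : R * 'rV[R]_m) (K D : set (R * 'rV[R]_m)).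

Lemma open_enorm_ball (e : 'rV[R]_m) (r : R) : open [set u | enorm (e - u) < r].
Proof.
rewrite -[X in open X]/((fun u => enorm (e - u)) @^-1` [set y | y < r]).
apply: open_comp; last exact: open_lt.
by move=> u _; exact: enorm_sub_continuous.
Qed.

Lemma nbhs_enorm2 w (V : set (R * 'rV[R]_m)) : nbhs w V ->
  exists2 d, 0 < d & forall q, enorm2 (q - w) < d -> V q.
Proof.
move=> /nbhs_ballP[d /= d0 dV]; exists d => // q qd; apply: dV.
rewrite -ball_normE /ball_/= distrC.
rewrite (le_lt_trans _ qd)// /Num.norm/= ge_max.
rewrite (ler_fst_enorm2 (q - w)) /=.
exact: le_trans (ler_norm_enorm _) (ler_snd_enorm2 (q - w)).
Qed.

Lemma lsc_on_near D (F : R * 'rV[R]_m -> set 'rV[R]_m) w e (r : R) :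
  lsc_on D F -> D w -> F w e -> 0 < r ->
  exists2 V, nbhs w V & forall q, D q -> V q -> exists2 u, F q u & enorm (e - u) < r.
Proof.
move=> Flsc Dw Fwe r0; have [V [oV HV]] := Flsc _ (open_enorm_ball e r).
exists V.
  apply: open_nbhs_nbhs; split=> //; apply/(HV _ Dw); exists e; split=> //=.
  by rewrite subrr enorm0.
by move=> q Dq /(HV _ Dq)[u [Fu ru]]; exists u.
Qed.

(** Near [p] with [e] in [F p], lower semicontinuity gives values of norm at most [enorm e + 1];
    compactness merges these local bounds. *)
Lemma lsc_on_bounded_selection D (F : R * 'rV[R]_m -> set 'rV[R]_m) C :
  lsc_on D F -> compact C -> C `<=` D -> (forall p, C p -> F p !=set0) ->
  exists M, forall p, C p -> exists2 e, F p e & enorm e <= M.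
Proof.
move=> Flsc cC CD CF.
have /compact_near_coveringP := cC.
move=> /(_ R (+oo : set_system R) (fun M p => D p -> exists2 e, F p e & enorm e <= M)) H.
have [|M [_ HM]] := H _ _.
  move=> p Cp; have [e Fe] := CF p Cp.
  have [V Vp HV] := lsc_on_near _ _ _ _ _ Flsc (CD _ Cp) Fe ltr01.
  exists (V, [set M | enorm e + 1 <= M]).
    by split=> //=; apply: nbhs_pinfty_ge; exact: num_real.
  move=> [q M] /= [Vq eM] Dq; have [u Fu eu] := HV q Dq Vq.
  exists u => //; rewrite (le_trans _ eM)// -(subKr e u).
  by rewrite (le_trans (enormD _ _))// enormN lerD2l ltW.
(* The filter at [+oo] only yields bounds strictly above [M]. *)
exists (M + 1) => p Cp; apply: HM => //; last exact: CD.
by rewrite ltrDl.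
Qed.

(** Lower semicontinuity puts hull vectors [(1, u)] near [(1, e)] at all nearby points of [K]. The
    point of [K] so found has a time slightly off [w.1 + t]; [h] is its actual time increment. *)
Lemma lsc_tangent_step K D (F : R * 'rV[R]_m -> set 'rV[R]_m) w e (eps delta : R) :
  closed K -> K `<=` D -> lsc_on D F -> K w ->
  (\forall q \near w, K q -> forall u, F q u -> cl_conv_hull2 (contingent_cone K q) (1, u)) ->
  F w e -> 0 < eps -> 0 < delta ->
  exists h y, [/\ 0 < h, h < delta, K (w.1 + h, y) & enorm (y - w.2 - h *: e) <= eps * h].
Proof.
move=> Kcl KD Flsc Kw Ktan Fe eps0 delta0.
have e0 := enorm_ge0 e.
(* [c <= 1 / 2] keeps [h] between [t / 2] and [3 t / 2]; the other bound makes the space error and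
   the time error times [enorm e] total at most [eps t / 2]. *)
pose c := Num.min (1 / 2) (eps / (2 * (1 + enorm e))).
have c0 : 0 < c by rewrite lt_min !divr_gt0// mulr_gt0// ltr_pwDl.
have c2 : c <= 1 / 2 by rewrite ge_min lexx.
have ce : 2 * c * (1 + enorm e) <= eps.
  have : c <= eps / (2 * (1 + enorm e)) by rewrite ge_min lexx orbT.
  by rewrite ler_pdivlMr; [lra|rewrite mulr_gt0// ltr_pwDl].
have [d d0 Hd] : exists2 d, 0 < d & forall t, 0 <= t -> t < d ->
    exists2 q, K q & enorm2 (w + t *: (1, e) - q) <= c * t.
  apply: liminf_cl_conv_contingent => // r r0.
  have [V Vw HV] := lsc_on_near _ _ _ _ _ Flsc (KD _ Kw) Fe r0.
  have [d d0 Hd] := nbhs_enorm2 _ _ (filterI Vw Ktan).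
  exists d => // q Kq /Hd[Vq Kq']; have [u Fu eu] := HV q (KD _ Kq) Vq.
  exists (1, u); first exact: Kq'.
  have -> : (1, u) - (1, e) = (0, u - e) :> R * 'rV[R]_m by congr pair; rewrite /= subrr.
  by rewrite enorm2_pair0 enormB ltW.
pose t := Num.min d delta / 2.
have t0 : 0 < t by rewrite divr_gt0// lt_min d0.
have td : t < d by rewrite ltr_pdivrMr// gt_min; apply/orP; left; lra.
have tdelta : 2 * t <= delta by rewrite /t mulrC divfK// ge_min lexx orbT.
have [[t' y] Kq qt] := Hd t (ltW t0) td.
have := le_trans (ler_fst_enorm2 _) qt; have := le_trans (ler_snd_enorm2 _) qt.
rewrite /= [t *: 1]mulr1 => yt; rewrite ler_norml => /andP[ht1 ht2].
have ct : c * t <= t / 2 by rewrite mulrC ler_pM2l//; lra.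
exists (t' - w.1), y; split; [lra|lra|by rewrite addrC subrK|].
have -> : y - w.2 - (t' - w.1) *: e = - (w.2 + t *: e - y) + (t - (t' - w.1)) *: e.
  by rewrite (scalerBl t) opprB opprD !addrA subrK.
rewrite (le_trans (enormD _ _))// enormN enormZ.
have tt : `|t - (t' - w.1)| <= c * t by rewrite ler_norml; apply/andP; split; lra.
have := ler_wpM2r e0 tt.
have : c * t * (1 + enorm e) <= eps * (t' - w.1).
  have h1 : t * (2 * c * (1 + enorm e)) <= t * eps by rewrite ler_pM2l.
  have h2 : eps * (t / 2) <= eps * (t' - w.1) by rewrite ler_pM2l//; lra.
  lra.
lra.
Qed.

End LowerSemicontinuity.

(** * Absolutely continuous curves over null sets *)

Section AbsolutelyContinuous.
Context {R : realType} {m : nat}.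
Local Notation mu := (@lebesgue_measure R).

(** Half-open intervals stay disjoint when the closed ones share endpoints, so their measures add
    up. *)
Lemma sum_disjoint_itv_le (k : nat) (u v : 'I_k -> R) (W : set R) : open W ->
  (forall i, u i <= v i) -> (forall i j, i != j -> v i <= u j \/ v j <= u i) ->
  (forall i, `[u i, v i] `<=` W) ->
  ((\sum_(i < k) (v i - u i))%:E <= mu W)%E.
Proof.
move=> oW uv dis uvW; pose F (i : 'I_k) : set R := `[u i, v i[%classic.
have mF : measurable (\big[setU/set0]_(i < k) F i).
  by apply: bigsetU_measurable => i _; exact: measurable_itv.
have FW : \big[setU/set0]_(i < k) F i `<=` W.
  elim/big_ind : _ => [//|A B AW BW x [/AW|/BW]//|i _ x].
  by rewrite /F /= in_itv/= => /andP[ux /ltW xv]; apply: (uvW i); rewrite /= in_itv/= ux.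
have muF i : mu (F i) = (v i - u i)%:E.
  rewrite /F lebesgue_measure_itv/= lte_fin; case: ltP => [//|vu].
  have -> : v i = u i by apply/eqP; rewrite eq_le vu uv.
  by rewrite subrr.
have triv : trivIset setT F.
  apply/trivIsetP => i j _ _ /dis ij; rewrite -subset0 => x [].
  rewrite /F /= !in_itv/= => /andP[ui vi] /andP[uj vj].
  by case: ij; lra.
have muE : mu (\big[setU/set0]_(i < k) F i) = (\sum_(i < k) mu (F i))%E.
  by apply: measure_semi_additive_ord => // i; exact: measurable_itv.
rewrite -sumEFin; under eq_bigr => i _ do rewrite -muF.
by rewrite -muE; apply: le_measure => //; rewrite inE//; exact: open_measurable.
Qed.

Lemma abs_cont_onS (a b : R) (z : R -> 'rV[R]_m) : abs_cont_on a b z ->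
  forall e, 0 < e -> exists2 d, 0 < d &
    forall s t, a <= s -> s <= t -> t <= b -> t - s < d -> enorm (z t - z s) < e.
Proof.
move=> zac e /zac[d [d0 Hd]]; exists d => // s t sa st tb std.
have := Hd 1%N (fun=> s) (fun=> t); rewrite !big_ord1; apply=> //.
by move=> i j; rewrite !ord1 eqxx.
Qed.

(* Witness: [psi t] is the supremum of the variation of [z] plus [M] times the length over
   families of disjoint intervals of [[a, t]] inside a small open neighbourhood of [N]. *)
Lemma null_set_variation (a b M eps : R) (z : R -> 'rV[R]_m) (N : set R) :
  abs_cont_on a b z -> mu.-negligible N -> 0 <= M -> 0 < eps ->
  exists psi : R -> R, [/\
    forall s t, a <= s -> s <= t -> t <= b -> psi s <= psi t,
    forall t, a <= t -> t <= b -> 0 <= psi t <= eps &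
    forall t, a <= t -> t < b -> N t -> exists2 d, 0 < d &
      forall h, 0 < h -> h < d -> t + h <= b ->
        enorm (z (t + h) - z t) + M * h <= psi (t + h) - psi t].
Proof.
move=> zac [A [mA A00 NA]] M0 eps0.
have {A00} A0 : mu A = 0%E by exact: A00.
have eps2 : 0 < eps / 2 by rewrite divr_gt0.
have [dz [dz0 Hz]] := zac _ eps2.
(* Total length below [r] leaves [eps / 2] for the variation of [z] and [eps / 2] for [M] times the
   length. *)
pose r := Num.min dz (eps / (2 * (M + 1))).
have r0 : 0 < r by rewrite lt_min dz0 divr_gt0// mulr_gt0// ltr_wpDl.
have [W [oW AW Wr]] : exists W : set R, [/\ open W, A `<=` W & (mu W < r%:E)%E].
  have A_fin : (mu A < +oo)%E by rewrite A0 ltry.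
  have [W [oW AW Wr]] := lebesgue_regularity_outer mA A_fin r0.
  have mW : measurable W by exact: open_measurable.
  have WE : mu W = (mu (W `\` A) + mu (W `&` A))%E by exact: measureDI.
  exists W; split=> //; rewrite WE setIC (setIidl AW).
  by rewrite [X in (_ + X)%E]A0 adde0.
pose fam t (k : nat) (u v : 'I_k -> R) := [/\ forall i, a <= u i /\ u i <= v i /\ v i <= t,
  forall i j, i != j -> v i <= u j \/ v j <= u i & forall i, `[u i, v i] `<=` W].
pose S t := [set x | exists k u v, @fam t k u v /\
  x = \sum_(i < k) (enorm (z (v i) - z (u i)) + M * (v i - u i))].
have S0 t : S t 0.
  exists 0%N, (fun=> 0), (fun=> 0); split; last by rewrite big_ord0.
  by split; case.
have Sle t x : t <= b -> S t x -> x <= eps.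
  move=> tb [k [u [v [[uv dis uvW] ->]]]].
  have : \sum_(i < k) (v i - u i) < r.
    rewrite -lte_fin (le_lt_trans _ Wr)// sum_disjoint_itv_le// => i.
    by have [_ []] := uv i.
  rewrite lt_min => /andP[ltdz lteps].
  have := Hz k u v _ dis ltdz.
  have uvb i : a <= u i /\ u i <= v i /\ v i <= b.
    by have [? [? ?]] := uv i; rewrite (le_trans _ tb).
  move=> /(_ uvb) Hz'; rewrite big_split/= -mulr_sumr.
  move: lteps; rewrite ltr_pdivlMr ?mulr_gt0 ?ltr_wpDl//.
  have : 0 <= \sum_(i < k) (v i - u i).
    by apply: sumr_ge0 => i _; have [_ []] := uv i; lra.
  by nra.
have supS t : t <= b -> has_sup (S t).
  by move=> tb; split; [exists 0|exists eps => x; exact: Sle].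
exists (fun t => sup (S t)); split.
- move=> s t sa st tb; apply: ge_sup => [|x [k [u [v [[uv dis uvW] xE]]]]]; first by exists 0.
  apply: sup_upper_bound; first exact: supS.
  exists k, u, v; split=> //; split=> // i.
  by have [? [? ?]] := uv i; rewrite (le_trans _ st).
- move=> t ta tb; apply/andP; split; first by apply: sup_upper_bound; [exact: supS|].
  by apply: ge_sup => [|x]; [exists 0|exact: Sle].
- move=> t ta tb Nt.
  have /nbhs_ballP[d /= d0 dW] : nbhs t W.
      by apply: open_nbhs_nbhs; split=> //; apply: AW; exact: NA.
  exists d => // h h0 hd thb.
  rewrite lerBrDr -lerBrDl; apply: ge_sup; first by exists 0.
  move=> x [k [u [v [[uv dis uvW] ->]]]]; rewrite lerBrDl.
  apply: sup_upper_bound; first exact: supS.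
  (* [[t, t + h]] joins the family as index 0, the old intervals being shifted by one. *)
  exists k.+1, (fun i => oapp u t (unlift ord0 i)), (fun i => oapp v (t + h) (unlift ord0 i)).
  split; last first.
    rewrite big_ord_recl unlift_none/= (addrC t) addrK; congr +%R.
    by apply: eq_bigr => i _; rewrite liftK.
  split.
  + move=> i; case: unliftP => [j _|_] /=; last by split=> //; lra.
    by have [? [? ?]] := uv j; lra.
  + move=> i j; case: unliftP => [i' ->|->]; case: unliftP => [j' ->|->] //=.
    * by rewrite (inj_eq lift_inj); exact: dis.
    * by have [_ [_ ?]] := uv i'; left.
    * by have [_ [_ ?]] := uv j'; right.
  + move=> i; case: unliftP => [j _|_] /=; first exact: uvW.
    move=> y; rewrite /= in_itv/= => /andP[ty yth]; apply: dW.
    by rewrite /ball/= ltr_norml; lra.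
Qed.

End AbsolutelyContinuous.

(** * Right difference quotients and bounds along curves *)

Lemma near_dnbhs0_right {R : realType} (P : set R) :
  (\forall h \near 0^', P h) -> exists2 d, 0 < d & forall h, 0 < h -> h < d -> P h.
Proof.
move=> [d /= d0 Hd]; exists d => // h h0 hd; apply: Hd; last by rewrite /= gt_eqF.
by rewrite /ball/= sub0r normrN gtr0_norm.
Qed.

(** Almost everywhere the integral [F] of [k], extended by zero, has derivative [k], so its
    quotients eventually exceed [k - 1]; adding [t] to [F] restores the missing 1. *)
Lemma nondecreasing_dominating_primitive {R : realType} (T : R) (k : R -> R) :
  (@lebesgue_measure R).-integrable `[0, T] (EFin \o k) ->
  (forall t, t \in `[0, T] -> 0 <= k t) ->
  exists kappa : R -> R, [/\ forall s t, s <= t -> kappa s <= kappa t,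
    forall t, 0 <= t -> 0 <= kappa t &
    {ae @lebesgue_measure R, forall t, t \in `[0, T] -> exists2 d, 0 < d &
      forall h, 0 < h -> h < d -> h * k t <= kappa (t + h) - kappa t}].
Proof.
move=> ik k0; pose f := k \_ `[0, T].
have f0 x : 0 <= f x.
  by rewrite /f patchE; case: ifPn => //; rewrite inE => xT; apply: k0; rewrite inE.
have intf : (@lebesgue_measure R).-integrable setT (EFin \o f).
  rewrite /f -restrict_EFin; apply/integrable_restrict => //=.
  by rewrite setTI.
have intfS A : measurable A -> (@lebesgue_measure R).-integrable A (EFin \o f).
  by move=> mA; exact: integrableS intf.
pose F (x : R) := (\int[@lebesgue_measure R]_(t in `]-oo, x]) f t)%R.
have := @FTC1Ny R f (fun y => intfS _ (measurable_itv _)) (open_integrable_locally openT intf).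
rewrite -/F => aeF.
have F_nd s t : s <= t -> F s <= F t.
  move=> st; rewrite -subr_ge0 /F Rintegral_itvB//.
    by apply: Rintegral_ge0.
  exact: intfS.
exists (fun t => F t + t); split.
- by move=> s t st; rewrite lerD// F_nd.
- by move=> t t0; rewrite addr_ge0//; apply: Rintegral_ge0.
apply: filterS aeF; first exact: (ae_filter_ringOfSetsType (@lebesgue_measure R)).
move=> t [dF F't] tT.
have {}F't : h^-1 * (F (h + t) - F t) @[h --> 0^'] --> k t.
  have -> : (fun h => h^-1 * (F (h + t) - F t)) =
            (fun h => h^-1 *: ((F \o shift t) (h *: 1) - F t)).
    by apply/funext => h; rewrite /= [h *: 1]mulr1.
  have -> : k t = f t by rewrite /f patchE mem_set//; move: tT; rewrite inE.
  by rewrite -F't derive1E; exact: dF.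
have near1 : \forall h \near 0^', `|k t - h^-1 * (F (h + t) - F t)| < 1.
  exact: (cvgr_dist_lt _ _ F't _ ltr01).
have [d d0 Hd] := near_dnbhs0_right _ near1.
exists d => // h h0 hd.
have := Hd h h0 hd.
rewrite ltr_norml => /andP[_].
rewrite -(ltr_pM2l h0) mulrBr mulrA divff ?gt_eqF// mul1r mulr1 (addrC t h).
lra.
Qed.

Lemma derivable_enorm_right {R : realType} {m : nat} (z : R -> 'rV[R]_m.+1) (t e : R) :
  derivable z t 1 -> 0 < e ->
  exists2 d, 0 < d & forall h, 0 < h -> h < d ->
    enorm (z (t + h) - z t - h *: 'D_1 z t) <= e * h.
Proof.
move=> dz e0; set D := 'D_1 z t.
have cv : h^-1 *: (z (h + t) - z t) @[h --> 0^'] --> D.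
  have -> : (fun h => h^-1 *: (z (h + t) - z t)) =
            (fun h => h^-1 *: ((z \o shift t) (h *: 1) - z t)).
    by apply/funext => h; rewrite /= [h *: 1]mulr1.
  exact: dz.
have De : nbhs D [set v | enorm (D - v) < e].
  apply: open_nbhs_nbhs; split; first exact: open_enorm_ball.
  by rewrite /= subrr enorm0.
have near1 : \forall h \near 0^', enorm (D - h^-1 *: (z (h + t) - z t)) < e by exact: cv De.
have [d d0 Hd] := near_dnbhs0_right _ near1.
exists d => // h h0 hd; have := Hd h h0 hd.
rewrite -(ltr_pM2l h0) -{1}(gtr0_norm h0) -enormZ scalerBr scalerA divff ?gt_eqF//.
by rewrite scale1r enormB (addrC h t) mulrC => /ltW.
Qed.

(** By uniform continuity a bound up to [x] extends by a fixed length at the cost of adding 1. *)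
Lemma abs_cont_on_bounded {R : realType} {m : nat} (a b : R) (z : R -> 'rV[R]_m) :
  a <= b -> abs_cont_on a b z ->
  exists C, forall t, a <= t -> t <= b -> enorm (z t) <= C.
Proof.
move=> ab zac; have [d d0 Hd] := abs_cont_onS _ _ _ zac _ ltr01.
have ext C x s : a <= x -> s <= b -> s - x < d ->
    (forall t, a <= t -> t <= x -> enorm (z t) <= C) ->
    forall t, a <= t -> t <= s -> enorm (z t) <= C + 1.
  move=> ax sb sx HC t ta ts; have [tx|/ltW xt] := leP t x.
    by rewrite (le_trans (HC t ta tx))// lerDl.
  rewrite -(subrK (z x) (z t)) addrC (le_trans (enormD _ _))// lerD//; first exact: HC.
  by apply/ltW/Hd => //; [exact: le_trans ts sb|lra].
apply: (@real_induction _ a b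
  (fun s => exists C, forall t, a <= t -> t <= s -> enorm (z t) <= C)) => //.
- exists (enorm (z a)) => t ta ta'.
  by have -> : t = a by apply/eqP; rewrite eq_le ta ta'.
- move=> s sa sb Hs; have [x [[C HC] ax xs sx]] := Hs _ d0.
  by exists (C + 1); apply: (ext C x s) => //; lra.
- move=> s sa sb [C HC]; pose h := Num.min (b - s) (d / 2).
  have h0 : 0 < h by rewrite lt_min subr_gt0 sb divr_gt0.
  have hb : h <= b - s by rewrite ge_min lexx.
  have hd : h <= d / 2 by rewrite ge_min lexx orbT.
  exists h; split=> //; first lra.
  by exists (C + 1); apply: (ext C s (s + h)) => //; lra.
Qed.

(** * Limits in compact sets and the comparison step *)

(** The penalty [|q.1 - s|] plus twice the positive part of [g q - c] attains its minimum on [C],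
    and approximate solutions force that minimum to be 0. *)
Lemma compact_slice_limit {R : realType} {X : topologicalType} (C : set (R * X))
    (g : R * X -> R) (s c : R) : compact C -> continuous g ->
  (forall e, 0 < e -> exists q, [/\ C q, `|q.1 - s| <= e & g q <= c + e]) ->
  exists q, [/\ C q, q.1 = s & g q <= c].
Proof.
move=> cC cg HC; pose f q := `|q.1 - s| + (`|g q - c| + (g q - c)).
have cf : continuous f.
  move=> q; apply: cvgD.
    by apply: cvg_norm; apply: cvgB; [exact: cvg_fst|exact: cvg_cst].
  have gc : g p - c @[p --> q] --> g q - c by apply: cvgB; [exact: cg|exact: cvg_cst].
  by apply: cvgD => //; exact: cvg_norm.
have [||q] := @compact_EVT_min _ R f C _ cC.
- by have [q [Cq _ _]] := HC 1 ltr01; exists q.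
- exact: continuous_subspaceT.
rewrite inE => Cq qmin.
have fq : f q <= 0.
  rewrite -[leRHS]add0r; apply/ler_addgt0Pr => e e0.
  have e3 : 0 < e / 3 by rewrite divr_gt0.
  have [p [Cp ps gp]] := HC _ e3.
  rewrite add0r (le_trans (qmin p _)) ?inE// /f.
  have : `|g p - c| + (g p - c) <= 2 * (e / 3).
    by have [?|?] := ger0P (g p - c); lra.
  by lra.
have gq0 : 0 <= `|g q - c| + (g q - c) by have [?|?] := ger0P (g q - c); lra.
have := normr_ge0 (q.1 - s); rewrite /f in fq => q0.
exists q; split=> //.
  by apply/eqP; rewrite -subr_eq0 -normr_le0; lra.
by move: fq gq0; have [?|?] := ger0P (g q - c); lra.
Qed.

Lemma closed_enorm2_adherent {R : realType} {m : nat} (K : set (R * 'rV[R]_m)) w :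
  closed K -> (forall e, 0 < e -> exists2 q, K q & enorm2 (q - w) <= e) -> K w.
Proof.
move=> Kcl HK; apply: Kcl => V /nbhs_enorm2[d d0 dV].
have [q Kq qd] := HK _ (divr_gt0 d0 (ltr0n R 2)).
by exists q; split=> //; apply: dV; lra.
Qed.

(** The squared norm is at most 2, hence at most 4. This 2 is the factor in [expR (2 * kappa t)]. *)
Lemma box_enorm_le {R : realType} {n : nat} (b : 'rV[R]_n.+1) : box b -> enorm b <= 2.
Proof.
move=> [b1 b2]; rewrite -[leRHS]ger0_norm// -sqrtr_sqr ler_wsqrtr//.
rewrite (bigD1 ord_max)//=.
have : b ord0 ord_max ^+ 2 <= 1 by rewrite -real_normK ?num_real// exprn_ile1.
lra.
Qed.

(* One step of the comparison function phi: [q0], [q1] are successive values of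
   [psi + 2 c (t - t0)]. *)
Lemma comparison_step {R : realType} (k0 k1 c q0 q1 g : R) :
  0 <= c -> c <= k1 - k0 -> 0 <= k0 -> 0 <= q0 -> 0 <= g -> g <= q1 - q0 ->
  expR (2 * k0) * q0 * (1 + 2 * c) + g <= expR (2 * k1) * q1.
Proof.
move=> c0 ck k00 q00 g0 gq.
have E1 : 1 <= expR (2 * k1) by rewrite -[leLHS]expR0 ler_expR; lra.
have E2 : expR (2 * k0) * (1 + 2 * c) <= expR (2 * k1).
  have -> : 2 * k1 = 2 * k0 + 2 * (k1 - k0) by ring.
  rewrite expRD ler_pM2l ?expR_gt0//; apply: le_trans (expR_ge1Dx _); lra.
have : expR (2 * k0) * (1 + 2 * c) * q0 <= expR (2 * k1) * q0 by rewrite ler_wpM2r.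
have : 1 * g <= expR (2 * k1) * (q1 - q0) by rewrite ler_pM.
lra.
Qed.

(** * Invariance of the graph of [P] along trajectories *)

Theorem theorem4p14 (R : realType) (n : nat) (T : R)
  (E : R -> 'rV[R]_n.+1 -> set 'rV[R]_n.+1)
  (P : R -> set 'rV[R]_n.+1)
  (* (E1) *)
  (E1 : forall t z, t \in `[0, T] ->
     E t z !=set0 /\ closed (E t z) /\
     (forall u v (l : R), E t z u -> E t z v -> 0 <= l -> l <= 1 ->
        E t z (l *: u + (1 - l) *: v)))
  (* (E6) closed graph *)
  (E6a : closed [set p : (R * 'rV[R]_n.+1) * 'rV[R]_n.+1 |
            p.1.1 \in `[0, T] /\ E p.1.1 p.1.2 p.2])
  (* (E6) lower semicontinuity *)
  (E6b : lsc_on [set p : R * 'rV[R]_n.+1 | p.1 \in `[0, T]]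
            (fun p => E p.1 p.2))
  (* (ELC) *)
  (ELC : forall r : R, 0 < r -> exists k : R -> R,
     (@lebesgue_measure R).-integrable `[0, T] (fun t => (k t)%:E) /\
     (forall t, t \in `[0, T] -> 0 <= k t) /\
     (forall t x y, t \in `[0, T] -> enorm x <= r -> enorm y <= r ->
        E t x `<=` [set w | exists a b, [/\ E t y a, box b &
                        w = a + (k t * enorm (x - y)) *: b]]))
  (* P : closed graph, nonempty values *)
  (Pcl : closed [set p : R * 'rV[R]_n.+1 | p.1 \in `[0, T] /\ P p.1 p.2])
  (Pne : forall t, t \in `[0, T] -> P t !=set0)
  (* tangency condition *)
  (Htan : forall t z, t \in `]0, T[ -> P t z ->
     forall e, E t z e ->
       cl_conv_hull2
         (contingent_cone [set p : R * 'rV[R]_n.+1 | p.1 \in `[0, T] /\ P p.1 p.2] (t, z))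
         (1, e)) :
  forall t0 z0, t0 \in `]0, T[ -> P t0 z0 ->
  forall z : R -> 'rV[R]_n.+1,
    abs_cont_on t0 T z ->
    {ae (@lebesgue_measure R), forall t, t \in `[t0, T] ->
        derivable z t 1 /\ E t (z t) ('D_1 z t)} ->
    z t0 = z0 ->
    forall t, t \in `[t0, T] -> P t (z t).
Proof.
suff main (t0 t1 : R) z : 0 < t0 -> t0 < T -> t0 <= t1 -> t1 <= T -> P t0 (z t0) ->
    abs_cont_on t0 T z ->
    {ae (@lebesgue_measure R), forall t, t \in `[t0, T] ->
        derivable z t 1 /\ E t (z t) ('D_1 z t)} -> P t1 (z t1).
  move=> t0 z0 + Pz0 z zac zae zt0 t1; rewrite !in_itv/= => /andP[? ?] /andP[? ?].
  by apply: (main t0 t1) => //; rewrite zt0.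
move=> t0_gt0 t0T t01 t1T Pzt0 zac zae.
set K := [set p : R * 'rV[R]_n.+1 | _] in Pcl Htan.
pose D := [set p : R * 'rV[R]_n.+1 | p.1 \in `[0, T]].
have KD : K `<=` D by move=> q [].
have inK (t : R) y : 0 <= t -> t <= T -> P t y -> K (t, y).
  by move=> t_ge0 tT Pty; split=> //; rewrite in_itv/= t_ge0.
have [C0 zC0] := abs_cont_on_bounded _ _ _ (ltW t0T) zac.
(* The ball of radius [r] contains every point within distance 1 of the trajectory, hence every [y]
   compared with it. *)
pose r : R := `|C0| + 1.
have r0 : 0 < r by rewrite ltr_wpDl.
have zr (t : R) : t0 <= t -> t <= T -> enorm (z t) + 1 <= r.
  by move=> ta tb; rewrite lerD2r (le_trans (zC0 t ta tb))// ler_norm.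
have [k [kint [k_ge0 kLip]]] := ELC r r0.
have [kappa [kappa_nd kappa_ge0 kappa_ae]] :=
  nondecreasing_dominating_primitive _ _ kint k_ge0.
have [M HM] : exists M, forall p, (`[0, T] `*` [set v | enorm (0 - v) <= r]) p ->
    exists2 e, E p.1 p.2 e & enorm e <= M.
  apply: (lsc_on_bounded_selection D (fun p => E p.1 p.2)) => //.
  - apply: compact_setX; first exact: segment_compact.
    exact: compact_enorm_ball.
  - by move=> p [].
  - by move=> p [pT _]; have [] := E1 p.1 p.2 pT.
pose good (t : R) := (t \in `[t0, T] -> derivable z t 1 /\ E t (z t) ('D_1 z t)) /\
  (t \in `[0, T] -> exists2 d, 0 < d &
    forall h, 0 < h -> h < d -> h * k t <= kappa (t + h) - kappa t).
have good_ae : (@lebesgue_measure R).-negligible (~` [set t | good t]).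
  exact: (@filterI _ _ (ae_filter_ringOfSetsType (@lebesgue_measure R)) _ _ zae kappa_ae).
have H (e : R) : 0 < e -> e <= 1 -> exists2 y, P t1 y & enorm (z t1 - y) <= e.
  move=> e0 e1; pose B : R := expR (2 * kappa t1).
  have B0 : 0 < B := expR_gt0 _.
  have T2 : 0 < 1 + 2 * T by lra.
  (* Since [psi <= c] and [t1 - t0 <= T], this [c] gives [phi t1 <= e]. *)
  have [c c0 cE] : exists2 c : R, 0 < c & B * (c * (1 + 2 * T)) = e.
    exists (e / (B * (1 + 2 * T))); first by rewrite divr_gt0// mulr_gt0.
    by field; rewrite !gt_eqF.
  (* [|M|] bounds the selected velocity, and 1 is the accuracy of the tangent step taken at bad
     times. *)
  have M0 : 0 <= `|M| + 1 by rewrite addr_ge0.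
  have [psi [psi_nd psi_le psi_step]] := null_set_variation _ _ _ _ _ _ zac good_ae M0 c0.
  (* The slope [2 c] pays for two errors [c h] at good times: the derivative of [z] and the tangent
     step. *)
  pose q (t : R) : R := psi t + 2 * c * (t - t0).
  pose phi (t : R) : R := expR (2 * kappa t) * q t.
  have q_nd (s t : R) : t0 <= s -> s <= t -> t <= T -> q s <= q t.
    move=> sa st tb; apply: lerD; first exact: psi_nd.
    by rewrite ler_pM2l ?mulr_gt0// lerD2r.
  have q_ge0 (t : R) : t0 <= t -> t <= T -> 0 <= q t.
    move=> ta tb; have /andP[p0 _] := psi_le t ta tb.
    by rewrite addr_ge0// mulr_ge0 ?subr_ge0// mulr_ge0// ltW.
  have phi_nd (s t : R) : t0 <= s -> s <= t -> t <= T -> phi s <= phi t.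
    move=> sa st tb; apply: ler_pM; [exact: expR_ge0| | |exact: q_nd].
      by apply: q_ge0 => //; exact: le_trans tb.
    by rewrite ler_expR ler_pM2l// kappa_nd.
  have phi_le : phi t1 <= e.
    rewrite -cE ler_pM2l//; have /andP[_ p1] := psi_le t1 t01 t1T.
    have : c * (t1 - t0) <= c * T by apply: ler_wpM2l; [exact: ltW|lra].
    by rewrite /q; lra.
  pose A (t : R) := exists2 y, P t y & enorm (z t - y) <= phi t.
  suff [y Py yz] : A t1 by exists y => //; exact: le_trans yz phi_le.
  apply: (@real_induction _ t0 t1 A) => //.
  - exists (z t0); first exact: Pzt0.
    by rewrite subrr enorm0 mulr_ge0 ?expR_ge0//; apply: q_ge0 => //; exact: ltW.
  - move=> s t0s st1 As; have sT : s <= T := le_trans st1 t1T.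
    have cC : compact (K `&` (`[0, T] `*` [set v | enorm (z s - v) <= phi s + 1])).
      rewrite setIC; apply: compact_closedI => //; apply: compact_setX.
        exact: segment_compact.
      exact: compact_enorm_ball.
    have cg : continuous (fun p : R * 'rV[R]_n.+1 => enorm (z s - p.2)).
      move=> p; apply: (@continuous_comp _ _ _ snd (fun v : 'rV[R]_n.+1 => enorm (z s - v)) p).
        exact: cvg_snd.
      exact: enorm_sub_continuous.
    have [|[s' y] [[[_ Py] _] /= sE ys]] := compact_slice_limit _ _ s (phi s) cC cg.
      (* The cap 1 keeps the approximating pairs in the compact set of radius [phi s + 1];
         monotonicity of [phi] replaces [phi x] by [phi s]. *)
      move=> d d0; have d1 : 0 < Num.min d 1 by rewrite lt_min d0 ltr01.
      have [d' d'0 Hd'] := abs_cont_onS _ _ _ zac _ d1.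
      have [x [[y Py yx] t0x xs sx]] : exists x, [/\ A x, t0 <= x, x <= s & s - Num.min d d' < x].
        by apply: As; rewrite lt_min d0.
      have dd : Num.min d d' <= d by rewrite ge_min lexx.
      have dd' : Num.min d d' <= d' by rewrite ge_min lexx orbT.
      have zsx : enorm (z s - z x) < Num.min d 1 by apply: Hd' => //; clear -sx dd'; lra.
      have sy : enorm (z s - y) <= phi s + Num.min d 1.
        rewrite -(subrKA (z x)) addrC (le_trans (enormD _ _))// [leLHS]addrC addrC lerD//.
          by apply: (le_trans yx); exact: phi_nd.
        exact: ltW.
      exists (x, y); split.
      + have x0 : 0 <= x := le_trans (ltW t0_gt0) t0x.
        have xT : x <= T := le_trans xs sT.
        split; first exact: inK.
        split; first by rewrite /= in_itv/= x0.
        by rewrite /= (le_trans sy)// lerD2l ge_min lexx orbT.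
      + by rewrite /= ler_norml; clear -xs sx dd d0; lra.
      + by rewrite /= (le_trans sy)// lerD2l ge_min lexx.
    by exists y => //; rewrite -sE.
  - move=> s t0s st1 [y Py ys].
    have sT : s < T by exact: lt_le_trans t1T.
    have s0 : 0 < s by exact: lt_le_trans t0s.
    have sI : s \in `[0, T] by rewrite in_itv/= !ltW.
    have sI0 : s \in `[t0, T] by rewrite in_itv/= t0s ltW.
    have phis1 : phi s <= 1.
      by rewrite (le_trans (phi_nd s t1 _ _ _)) ?(ltW st1)// (le_trans phi_le).
    have zsr : enorm (z s) <= r by apply: le_trans (zr s t0s (ltW sT)); rewrite lerDl.
    have yr : enorm y <= r.
      apply: le_trans (zr s t0s (ltW sT)).
      by rewrite -(subKr (z s) y) (le_trans (enormD _ _))// enormN lerD2l (le_trans ys).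
    (* Tangency is assumed only at interior times, and these form a neighbourhood of [s]. *)
    have Ktan : \forall p \near (s, y), K p -> forall u, E p.1 p.2 u ->
        cl_conv_hull2 (contingent_cone K p) (1, u).
      have sI1 : s \in `]0, T[ by rewrite in_itv/= s0.
      have near_s : nbhs (s, y) [set p : R * 'rV[R]_n.+1 | p.1 \in `]0, T[].
        exists ([set x | x \in `]0, T[], setT) => [|p []//].
        by split; [exact: near_in_itvoo|exact: filterT].
      apply: (@filterS _ (nbhs (s, y)) (nbhs_filter (s, y)) _ _ _ near_s).
      by move=> -[p1 p2] p1T [_ Pp] u; exact: (Htan p1 p2 p1T Pp u).
    have Ksy : K (s, y) by [].
    have step f (eps delta : R) : E s y f -> 0 < eps -> 0 < delta ->
        exists h y', [/\ 0 < h, h < delta, P (s + h) y' & enorm (y' - y - h *: f) <= eps * h].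
      move=> Ef eps0 delta0.
      have [h [y' [h0 hd [_ Py'] yh]]] :=
        lsc_tangent_step K D (fun p => E p.1 p.2) (s, y) f eps delta
          Pcl KD E6b Ksy Ktan Ef eps0 delta0.
      by exists h, y'.
    have [[/(_ sI0)[dz Ez] /(_ sI)[d1 d10 Hk]]|ngs] := pselect (good s).
      (* Good time: the Lipschitz condition gives [a] in [E s y] within [2 k s phi s] of the
         velocity of [z]; the step follows [a]. *)
      have [a [b [Ea bb zE]]] := kLip s (z s) y sI zsr yr _ Ez.
      have [d2 d20 Hd2] := derivable_enorm_right _ _ _ dz c0.
      have delta0 : 0 < Num.min (Num.min d1 d2) (t1 - s) by rewrite !lt_min d10 d20 subr_gt0.
      have [h [y' [h0 + Py' yh]]] := step a c _ Ea c0 delta0.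
      rewrite !lt_min => /andP[/andP[hd1 hd2] hst].
      have hT : s + h <= t1 by clear -hst; lra.
      exists h; split=> //; exists y' => //.
      have ks := k_ge0 s sI.
      have psih : psi s <= psi (s + h) by apply: psi_nd; [|rewrite lerDl ltW|exact: le_trans t1T].
      apply: (@le_trans _ _ (phi s * (1 + 2 * (h * k s)) + 2 * c * h)); last first.
        apply: comparison_step.
        + by rewrite mulr_ge0// ltW.
        + exact: Hk.
        + by apply: kappa_ge0; exact: ltW.
        + by apply: q_ge0 => //; exact: ltW.
        + by rewrite !mulr_ge0// ltW.
        + by rewrite /q; clear -psih; lra.
      have -> : z (s + h) - y' = (z s - y) + (z (s + h) - z s - h *: 'D_1 z s) +
          h *: ('D_1 z s - a) - (y' - y - h *: a).
        by apply/rowP => i; rewrite !mxE; ring.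
      have -> : 'D_1 z s - a = (k s * enorm (z s - y)) *: b by rewrite zE addrAC subrr add0r.
      rewrite (le_trans (enormD _ _))// enormN.
      have n1 := enormD (z s - y + (z (s + h) - z s - h *: 'D_1 z s))
        (h *: ((k s * enorm (z s - y)) *: b)).
      have n2 := enormD (z s - y) (z (s + h) - z s - h *: 'D_1 z s).
      have n3 := Hd2 h h0 hd2.
      have n4 : enorm (h *: ((k s * enorm (z s - y)) *: b)) <= h * (k s * phi s * 2).
        rewrite !enormZ gtr0_norm// ler_pM2l// ger0_norm ?mulr_ge0 ?enorm_ge0//.
        apply: ler_pM; rewrite ?mulr_ge0 ?enorm_ge0//; last exact: box_enorm_le.
        exact: ler_wpM2l.
      clear -ys yh n1 n2 n3 n4; lra.
    (* Bad time: no velocity is available, so any bounded [f] in [E s y] is followed and [psi]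
       absorbs both motions. *)
    have [d d0 Hd] := psi_step s t0s sT ngs.
    have [f Ef fM] : exists2 f, E s y f & enorm f <= M.
      by apply: (HM (s, y)); split => //=; rewrite sub0r enormN.
    have delta0 : 0 < Num.min d (t1 - s) by rewrite lt_min d0 subr_gt0.
    have [h [y' [h0 + Py' yh]]] := step f 1 _ Ef ltr01 delta0.
    rewrite lt_min => /andP[hd hst].
    have hT : s + h <= t1 by clear -hst; lra.
    exists h; split=> //; exists y' => //.
    have psih := Hd h h0 hd (le_trans hT t1T).
    have MM := ler_norm M.
    (* The rate is 0 here because only the monotonicity of [kappa] is known at [s]. *)
    apply: (@le_trans _ _ (phi s * (1 + 2 * 0) + (enorm (z (s + h) - z s) + (`|M| + 1) * h)));
      last first.
      apply: comparison_step => //.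
      + by rewrite subr_ge0 kappa_nd// lerDl ltW.
      + by apply: kappa_ge0; exact: ltW.
      + by apply: q_ge0 => //; exact: ltW.
      + by rewrite addr_ge0 ?enorm_ge0// mulr_ge0// ltW.
      + have ch : 0 < 2 * c * h by rewrite !mulr_gt0.
        by rewrite /q; clear -psih MM ch; lra.
    have -> : z (s + h) - y' = (z s - y) + (z (s + h) - z s) - (y' - y - h *: f) - h *: f.
      by apply/rowP => i; rewrite !mxE; ring.
    rewrite (le_trans (enormD _ _))// enormN enormZ gtr0_norm//.
    have n1 := enormD (z s - y + (z (s + h) - z s)) (- (y' - y - h *: f)).
    rewrite enormN in n1.
    have n2 := enormD (z s - y) (z (s + h) - z s).
    have n3 : h * enorm f <= h * `|M| by rewrite ler_pM2l// (le_trans fM).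
    clear -ys yh n1 n2 n3; lra.
suff : K (t1, z t1) by case.
(* As [e] tends to 0, points of [P t1] approach [z t1], and [K] is closed. *)
apply: closed_enorm2_adherent => // e e0.
have [||y Py yz] := H (Num.min e 1); [by rewrite lt_min e0 ltr01|by rewrite ge_min lexx orbT|].
exists (t1, y); first by apply: inK => //; lra.
have -> : (t1, y) - (t1, z t1) = (0, y - z t1) :> R * 'rV[R]_n.+1.
  by congr pair; rewrite /= subrr.
by rewrite enorm2_pair0 enormB (le_trans yz)// ge_min lexx.
Qed.
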